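(* Let $\mathcal{G}$ be a groupoid with a finite set of objects and let $\mathrm{rep}(\mathcal{S}_{\mathcal{G}})$ be a set of representatives of the subgroupoids of $\mathcal{G}$ with exactly one object modulo conjugation. Then the ghost map $$\mathfrak{g}:\mathscr{B}(\mathcal{G})\longrightarrow\prod_{\mathcal{H}\in\mathrm{rep}(\mathcal{S}_{\mathcal{G}})}\mathbb{Z},\qquad \big[[X],[Y]\big]\longmapsto\big(|X^{\mathcal{H}}|-|Y^{\mathcal{H}}|\big)_{\mathcal{H}\in\mathrm{rep}(\mathcal{S}_{\mathcal{G}})}$$ is a monomorphism of rings.
   Context: A groupoid $\mathcal{G}=(\mathcal{G}_1,\mathcal{G}_0)$ is a small category in which every morphism is invertible, with source and target maps $\mathsf{s},\mathsf{t}$ and identities $\iota_x$; $gh$ is defined when $\mathsf{s}(g)=\mathsf{t}(h)$; $\mathcal{G}(x,y)$ is the set of arrows from $x$ to $y$ and $\mathcal{G}^x=\mathcal{G}(x,x)$. A right $\mathcal{G}$-set $(X,\varsigma)$ is a set $X$ with a map $\varsigma:X\to\mathcal{G}_0$ and an action $(x,g)\mapsto xg$, defined when $\varsigma(x)=\mathsf{t}(g)$, such that $\varsigma(xg)=\mathsf{s}(g)$, $x\,\iota_{\varsigma(x)}=x$, $(xg)h=x(gh)$ whenever defined. Morphisms commute with structure maps and actions. It is finite if $X$ is finite. $\mathcal{S}_{\mathcal{G}}$ is the set of subgroupoids with exactly one object (equivalently, pairs of an object $a$ and a subgroup $\mathcal{H}_1\le\mathcal{G}^a$); $\mathcal{H}$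 (object $a$) and $\mathcal{K}$ (object $b$) are conjugated iff there is $d\in\mathcal{G}(a,b)$ with $\mathcal{K}_1=d\mathcal{H}_1d^{-1}$. For $\mathcal{H}\in\mathcal{S}_{\mathcal{G}}$ with object $a$, $X^{\mathcal{H}}=\{x\in X\mid\varsigma(x)=a,\ xh=x\ \forall h\in\mathcal{H}_1\}$. The Burnside rig $\mathscr{L}(\mathcal{G})$ is the set of isomorphism classes $[X]$ of finite right $\mathcal{G}$-sets, with addition induced by disjoint union and multiplication by the fibered product $X\times_{\mathcal{G}_0}Y=\{(x,y)\mid\varsigma(x)=\vartheta(y)\}$ with diagonal action; zero $[(\emptyset,\emptyset)]$, unit $[(\mathcal{G}_0,\mathrm{Id})]$ with action $ag=\mathsf{s}(g)$ for $a=\mathsf{t}(g)$. The Burnside ring $\mathscr{B}(\mathcal{G})$ is the Grothendieck ring of $\mathscr{L}(\mathcal{G})$: classes $[a,b]$ of pairs in $\mathscr{L}(\mathcal{G})^2$ modulo $(a,b)\sim(c,d)\iff\exists e:\ a+d+e=c+b+e$, with $[a,b]+[c,d]=[a+c,b+d]$, $[a,b][c,d]=[ac+bd,ad+bc]$. *)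

(* Defs.v *)
From HB Require Import structures.
From mathcomp Require Import all_boot all_order all_algebra.
From mathcomp Require Import generic_quotient ring.
From mathcomp Require Import finmap.
From mathcomp Require Import boolp classical_sets functions cardinality.

Set Implicit Arguments.
Unset Strict Implicit.
Unset Printing Implicit Defensive.

Import GRing.Theory.
Local Open Scope ring_scope.
Local Open Scope quotient_scope.
Local Open Scope classical_set_scope.

(* The composite g h of the category is [comp g h e]; it is defined when the  *)
(* source of g is the target of h, as witnessed by e.                         *)
Record groupoid := Groupoid {
  obj : Type;
  arr : Type;
  src : arr -> obj;
  tgt : arr -> obj;
  ident : obj -> arr;
  inv : arr -> arr;
  comp : forall g h, src g = tgt h -> arr;
  src_ident : forall a, src (ident a) = a;
  tgt_ident : forall a, tgt (ident a) = a;
  src_inv : forall g, src (inv g) = tgt g;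
  tgt_inv : forall g, tgt (inv g) = src g;
  src_comp : forall g h (e : src g = tgt h), src (comp e) = src h;
  tgt_comp : forall g h (e : src g = tgt h), tgt (comp e) = tgt g;
  comp_assoc : forall g h k (e1 : src g = tgt h) (e2 : src (comp e1) = tgt k)
      (e3 : src h = tgt k) (e4 : src g = tgt (comp e3)),
    comp e2 = comp e4;
  comp_ident_l : forall g (e : src (ident (tgt g)) = tgt g), comp e = g;
  comp_ident_r : forall g (e : src g = tgt (ident (src g))), comp e = g;
  comp_inv_l : forall g (e : src (inv g) = tgt g), comp e = ident (src g);
  comp_inv_r : forall g (e : src g = tgt (inv g)), comp e = ident (tgt g)
}.

(* Finiteness of the objects is what makes the unit of the rig below a finite *)
(* G-set.                                                                     *)
Record fin_groupoid := FinGroupoid {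
  fin_groupoid_base :> groupoid;
  finite_obj : finite_set [set: obj fin_groupoid_base]
}.

Record gset (G : groupoid) := GSet {
  car :> Type;
  anchor : car -> obj G;
  act : forall x (g : arr G), anchor x = tgt g -> car;
  anchor_act : forall x g (e : anchor x = tgt g), anchor (act e) = src g;
  act_ident : forall x (e : anchor x = tgt (ident (anchor x))), act e = x;
  act_comp : forall x g h (e1 : anchor x = tgt g) (e2 : anchor (act e1) = tgt h)
      (e3 : src g = tgt h) (e4 : anchor x = tgt (comp e3)),
    act e2 = act e4
}.

(* Finiteness is a proposition, not a finType structure on the carrier: the   *)
(* finite G-sets must form a type that {classic _} can turn into a choiceType *)
(* and this would be a universe inconsistency if they contained finTypes.     *)
Record fin_gset (G : groupoid) := FinGSet {
  fin_gset_base :> gset G;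
  finite_car : finite_set [set: car fin_gset_base]
}.

Definition gset_morphism (G : groupoid) (X Y : gset G) (f : X -> Y) : Prop :=
  (forall x, anchor (f x) = anchor x) /\
  (forall x g (e : anchor x = tgt g) (e' : anchor (f x) = tgt g),
     f (act e) = act e').

Definition gset_iso (G : groupoid) (X Y : gset G) : Prop :=
  exists (f : X -> Y) (f' : Y -> X),
    [/\ gset_morphism f, gset_morphism f', cancel f f' & cancel f' f].

Lemma act_irr (G : groupoid) (X : gset G) (x x' : X) (g : arr G)
    (e : anchor x = tgt g) (e' : anchor x' = tgt g) :
  x = x' -> act e = act e'.
Proof. by move=> xx'; subst x'; rewrite (Prop_irrelevance e e'). Qed.

Lemma act_identE (G : groupoid) (X : gset G) (x : X) a
    (e : anchor x = tgt (ident a)) : act e = x.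
Proof.
have ax : a = anchor x by rewrite e tgt_ident.
by subst a; exact: act_ident.
Qed.

Section GSetIso.
Variable G : groupoid.
Implicit Types X Y Z : gset G.

Lemma gset_isoI X Y (f : X -> Y) (f' : Y -> X) :
  gset_morphism f -> cancel f f' -> cancel f' f -> gset_iso X Y.
Proof.
move=> fM fK f'K; exists f, f'; split=> //; case: fM => fa fg.
have f'a y : anchor (f' y) = anchor y by rewrite -fa f'K.
split=> // y g e e'; apply: (can_inj fK); rewrite f'K.
have e1 : anchor (f (f' y)) = tgt g by rewrite f'K.
by rewrite (fg _ _ _ e1); apply: act_irr; rewrite f'K.
Qed.

Lemma gset_iso_refl X : gset_iso X X.
Proof.
apply: (@gset_isoI X X id id) => //; split=> // x g e e'.
exact: act_irr.
Qed.

Lemma gset_iso_sym X Y : gset_iso X Y -> gset_iso Y X.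
Proof. by case=> f [f' [fM f'M fK f'K]]; exists f', f; split. Qed.

Lemma gset_iso_trans X Y Z : gset_iso X Y -> gset_iso Y Z -> gset_iso X Z.
Proof.
case=> f [f' [[fa fg] _ fK f'K]] [h [h' [[ha hg] _ hK h'K]]].
apply: (@gset_isoI X Z (h \o f) (f' \o h')); last 2 first.
- by move=> x /=; rewrite hK fK.
- by move=> z /=; rewrite f'K h'K.
split=> [x|x g e e'] /=; first by rewrite ha fa.
have e1 : anchor (f x) = tgt g by rewrite fa.
by rewrite (fg _ _ _ e1) (hg _ _ _ e').
Qed.

End GSetIso.

Section GSetOperations.
Variable G : groupoid.

Definition gset_empty : gset G.
Proof.
by refine (@GSet G void (fun v => match v with end)
  (fun v => match v with end) _ _ _); case.
Defined.

Definition unit_act (a : obj G) (g : arr G) (e : a = tgt g) : obj G := src g.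

Definition gset_unit : gset G.
Proof.
refine (@GSet G (obj G) id unit_act _ _ _) => //.
- by move=> a e; exact: src_ident.
- by move=> a g h e1 e2 e3 e4; rewrite /unit_act src_comp.
Defined.

Section SumProd.
Variables X Y : gset G.

Definition sum_anchor (u : (X + Y)%type) : obj G :=
  match u with inl x => anchor x | inr y => anchor y end.

Definition sum_act (u : (X + Y)%type) (g : arr G) :
    sum_anchor u = tgt g -> (X + Y)%type :=
  match u with
  | inl x => fun e => inl (act (e : anchor x = tgt g))
  | inr y => fun e => inr (act (e : anchor y = tgt g))
  end.

Definition gset_sum : gset G.
Proof.
refine (@GSet G (X + Y)%type sum_anchor sum_act _ _ _).
- by case=> x g e /=; exact: anchor_act.
- by case=> x e /=; rewrite act_ident.
- by case=> x g h e1 e2 e3 e4 /=; congr (_ _); exact: act_comp.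
Defined.

Definition fprod : Type := {p : X * Y | anchor p.1 = anchor p.2}.

Lemma fprod_inj (p q : fprod) : sval p = sval q -> p = q.
Proof.
by case: p q => [p pP] [q qP] /= pq; subst q; rewrite (Prop_irrelevance pP qP).
Qed.

Definition fprod_anchor (p : fprod) : obj G := anchor (sval p).1.

Lemma fprod_anchor2 (p : fprod) (g : arr G) :
  fprod_anchor p = tgt g -> anchor (sval p).2 = tgt g.
Proof. by rewrite /fprod_anchor (svalP p). Qed.

Lemma fprod_act_subproof (p : fprod) (g : arr G) (e : fprod_anchor p = tgt g) :
  anchor (act (e : anchor (sval p).1 = tgt g)) = anchor (act (fprod_anchor2 e)).
Proof. by rewrite !anchor_act. Qed.

Definition fprod_act (p : fprod) (g : arr G) (e : fprod_anchor p = tgt g) :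
    fprod :=
  exist (fun q : X * Y => anchor q.1 = anchor q.2)
    (act (e : anchor (sval p).1 = tgt g), act (fprod_anchor2 e))
    (fprod_act_subproof e).

Definition gset_prod : gset G.
Proof.
refine (@GSet G fprod fprod_anchor fprod_act _ _ _).
- by move=> p g e; rewrite /fprod_anchor /= anchor_act.
- by move=> p e; apply: fprod_inj; rewrite /= !act_identE; case: (sval p).
- by move=> p g h e1 e2 e3 e4; apply: fprod_inj => /=; congr (_, _);
    exact: act_comp.
Defined.

End SumProd.

Implicit Types X Y Z : gset G.

Lemma gset_sum_iso X X' Y Y' : gset_iso X X' -> gset_iso Y Y' ->
  gset_iso (gset_sum X Y) (gset_sum X' Y').
Proof.
case=> f [f' [[fa fg] _ fK f'K]] [h [h' [[ha hg] _ hK h'K]]].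
pose m T T' U U' (k : T -> T') (l : U -> U') (u : T + U) : T' + U' :=
  match u with inl x => inl (k x) | inr y => inr (l y) end.
apply: (@gset_isoI _ (gset_sum X Y) (gset_sum X' Y')
  (m _ _ _ _ f h) (m _ _ _ _ f' h')).
- split=> [[x|y]|[x|y] g e e'] //=.
  + by congr inl; exact: fg.
  + by congr inr; exact: hg.
- by case=> [x|y] /=; rewrite ?fK ?hK.
- by case=> [x|y] /=; rewrite ?f'K ?h'K.
Qed.

Lemma gset_sumC X Y : gset_iso (gset_sum X Y) (gset_sum Y X).
Proof.
pose sw T U (u : T + U) : U + T :=
  match u with inl x => inr x | inr y => inl y end.
apply: (@gset_isoI _ (gset_sum X Y) (gset_sum Y X) (sw _ _) (sw _ _)).
- by split=> [[x|y]|[x|y] g e e'] //=; congr (_ _); exact: act_irr.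
- by case.
- by case.
Qed.

Lemma gset_sumA X Y Z :
  gset_iso (gset_sum X (gset_sum Y Z)) (gset_sum (gset_sum X Y) Z).
Proof.
pose f (u : X + (Y + Z)) : X + Y + Z :=
  match u with
  | inl x => inl (inl x) | inr (inl y) => inl (inr y) | inr (inr z) => inr z
  end.
pose f' (u : X + Y + Z) : X + (Y + Z) :=
  match u with
  | inl (inl x) => inl x | inl (inr y) => inr (inl y) | inr z => inr (inr z)
  end.
apply: (@gset_isoI _ (gset_sum X (gset_sum Y Z)) (gset_sum (gset_sum X Y) Z)
  f f').
- split=> [[x|[y|z]]|[x|[y|z]] g e e'] //=.
  + by congr (inl (inl _)); exact: act_irr.
  + by congr (inl (inr _)); exact: act_irr.
  + by congr inr; exact: act_irr.
- by case=> [x|[y|z]].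
- by case=> [[x|y]|z].
Qed.

Lemma gset_sum0 X : gset_iso (gset_sum gset_empty X) X.
Proof.
pose f (u : void + X) : X := match u with inl v => of_void X v | inr x => x end.
apply: (@gset_isoI _ (gset_sum gset_empty X) X f inr).
- by split=> [[[]|x]|[[]|x] g e e'] //=; exact: act_irr.
- by case=> [[]|x].
- by [].
Qed.

Lemma gset_prod_iso X X' Y Y' : gset_iso X X' -> gset_iso Y Y' ->
  gset_iso (gset_prod X Y) (gset_prod X' Y').
Proof.
case=> f [f' [[fa fg] [f'a _] fK f'K]] [h [h' [[ha hg] [h'a _] hK h'K]]].
have mP (p : fprod X Y) : anchor (f (sval p).1) = anchor (h (sval p).2).
  by rewrite fa ha; exact: (svalP p).
have m'P (p : fprod X' Y') : anchor (f' (sval p).1) = anchor (h' (sval p).2).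
  by rewrite f'a h'a; exact: (svalP p).
pose m (p : fprod X Y) : fprod X' Y' :=
  exist (fun q : X' * Y' => anchor q.1 = anchor q.2) (_, _) (mP p).
pose m' (p : fprod X' Y') : fprod X Y :=
  exist (fun q : X * Y => anchor q.1 = anchor q.2) (_, _) (m'P p).
apply: (@gset_isoI _ (gset_prod X Y) (gset_prod X' Y') m m').
- split=> [p|p g e e'] /=; first exact: fa.
  by apply: fprod_inj => /=; congr (_, _); [exact: fg|exact: hg].
- by move=> p; apply: fprod_inj => /=; rewrite fK hK; case: (sval p).
- by move=> p; apply: fprod_inj => /=; rewrite f'K h'K; case: (sval p).
Qed.

Lemma gset_prodC X Y : gset_iso (gset_prod X Y) (gset_prod Y X).
Proof.
have swP (T U : gset G) (p : fprod T U) :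
  anchor (sval p).2 = anchor (sval p).1 by rewrite (svalP p).
pose sw T U (p : fprod T U) : fprod U T :=
  exist (fun q : U * T => anchor q.1 = anchor q.2) (_, _) (swP _ _ p).
apply: (@gset_isoI _ (gset_prod X Y) (gset_prod Y X) (sw _ _) (sw _ _)).
- split=> [p|p g e e'] /=; first by rewrite /fprod_anchor /= (svalP p).
  by apply: fprod_inj => /=; congr (_, _); exact: act_irr.
- by move=> p; apply: fprod_inj => /=; case: (sval p).
- by move=> p; apply: fprod_inj => /=; case: (sval p).
Qed.

Lemma gset_prodA X Y Z :
  gset_iso (gset_prod X (gset_prod Y Z)) (gset_prod (gset_prod X Y) Z).
Proof.
have f1P (p : fprod X (gset_prod Y Z)) :
  anchor (sval p).1 = anchor (sval (sval p).2).1 by exact: (svalP p).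
have f2P (p : fprod X (gset_prod Y Z)) :
    anchor (sval p).1 = anchor (sval (sval p).2).2.
  by rewrite (f1P p); exact: (svalP (sval p).2).
pose f (p : fprod X (gset_prod Y Z)) : fprod (gset_prod X Y) Z :=
  exist (fun q : gset_prod X Y * Z => anchor q.1 = anchor q.2)
    (exist (fun q : X * Y => anchor q.1 = anchor q.2) (_, _) (f1P p), _)
    (f2P p).
have g1P (p : fprod (gset_prod X Y) Z) :
    anchor (sval (sval p).1).2 = anchor (sval p).2.
  by rewrite -(svalP (sval p).1); exact: (svalP p).
have g2P (p : fprod (gset_prod X Y) Z) :
  anchor (sval (sval p).1).1 = anchor (sval (sval p).1).2 by exact: (svalP (sval p).1).
pose f' (p : fprod (gset_prod X Y) Z) : fprod X (gset_prod Y Z) :=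
  exist (fun q : X * gset_prod Y Z => anchor q.1 = anchor q.2)
    (_, exist (fun q : Y * Z => anchor q.1 = anchor q.2) (_, _) (g1P p))
    (g2P p).
apply: (@gset_isoI _ (gset_prod X (gset_prod Y Z))
  (gset_prod (gset_prod X Y) Z) f f').
- split=> [p|p g e e'] //=.
  apply: fprod_inj => /=; congr (_, _); last exact: act_irr.
  by apply: fprod_inj => /=; congr (_, _); exact: act_irr.
- move=> [[x [[y z] yz]] xyz]; apply: fprod_inj => /=; congr (_, _).
  exact: fprod_inj.
- move=> [[[[x y] xy] z] xyz]; apply: fprod_inj => /=; congr (_, _).
  exact: fprod_inj.
Qed.

Lemma gset_prod1 X : gset_iso (gset_prod gset_unit X) X.
Proof.
pose f (p : fprod gset_unit X) : X := (sval p).2.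
pose f' (x : X) : fprod gset_unit X :=
  exist (fun q : gset_unit * X => anchor q.1 = anchor q.2) (anchor x, x)
    erefl.
apply: (@gset_isoI _ (gset_prod gset_unit X) X f f').
- split=> [p|p g e e'] /=; first by rewrite /f -(svalP p).
  exact: act_irr.
- by move=> [[a x] ax]; apply: fprod_inj => /=; rewrite -ax.
- by [].
Qed.

Lemma gset_prod0 X : gset_iso (gset_prod gset_empty X) gset_empty.
Proof.
pose f (p : fprod gset_empty X) : void := (sval p).1.
apply: (@gset_isoI _ (gset_prod gset_empty X) gset_empty f (of_void _)).
- by split=> [p|p]; case: (f p).
- by move=> p; case: (f p).
- by case.
Qed.

Lemma gset_prodDl X Y Z :
  gset_iso (gset_prod (gset_sum X Y) Z)
           (gset_sum (gset_prod X Z) (gset_prod Y Z)).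
Proof.
pose f (p : fprod (gset_sum X Y) Z) : fprod X Z + fprod Y Z :=
  match p with
  | exist (inl x, z) xz =>
      inl (exist (fun q : X * Z => anchor q.1 = anchor q.2) (x, z) xz)
  | exist (inr y, z) yz =>
      inr (exist (fun q : Y * Z => anchor q.1 = anchor q.2) (y, z) yz)
  end.
pose f' (u : fprod X Z + fprod Y Z) : fprod (gset_sum X Y) Z :=
  match u with
  | inl (exist (x, z) xz) =>
      exist (fun q : gset_sum X Y * Z => anchor q.1 = anchor q.2) (inl x, z) xz
  | inr (exist (y, z) yz) =>
      exist (fun q : gset_sum X Y * Z => anchor q.1 = anchor q.2) (inr y, z) yz
  end.
apply: (@gset_isoI _ (gset_prod (gset_sum X Y) Z)
  (gset_sum (gset_prod X Z) (gset_prod Y Z)) f f').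
- split=> [[[[x|y] z] xyz]|[[[x|y] z] xyz] g e e'] //=; congr (_ _);
  by apply: fprod_inj => /=; congr (_, _); exact: act_irr.
- by case=> [[[x|y] z] xyz].
- by case=> [[[x z] xz]|[[y z] yz]].
Qed.

End GSetOperations.

Definition fin_gset_empty (G : groupoid) : fin_gset G.
Proof.
refine (@FinGSet G (gset_empty G) _).
by rewrite (_ : [set: _] = set0); [exact: finite_set0|apply/seteqP; split; case].
Defined.

Definition fin_gset_unit (G : fin_groupoid) : fin_gset G :=
  @FinGSet G (gset_unit G) (finite_obj G).

Definition fin_gset_sum (G : groupoid) (X Y : fin_gset G) : fin_gset G.
Proof.
refine (@FinGSet G (gset_sum X Y) _).
apply: (@sub_finite_set _ _ (inl @` [set: X] `|` inr @` [set: Y])).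
  by case=> [x|y] _; [left; exists x|right; exists y].
by rewrite finite_setU; split; apply/finite_image/finite_car.
Defined.

Definition fin_gset_prod (G : groupoid) (X Y : fin_gset G) : fin_gset G.
Proof.
refine (@FinGSet G (gset_prod X Y) _).
rewrite -(preimage_setT (@sval _ _ : fprod X Y -> X * Y)).
apply: finite_preimage; first by move=> p q _ _; exact: fprod_inj.
by rewrite -setXTT; apply: finite_setX; exact: finite_car.
Defined.

Section BurnsideRig.
Variable G : fin_groupoid.

Definition iso_rel (X Y : {classic fin_gset G}) : bool :=
  `[< gset_iso (X : fin_gset G) (Y : fin_gset G) >].

Lemma iso_rel_refl : reflexive iso_rel.
Proof. by move=> X; apply/asboolP; exact: gset_iso_refl. Qed.

Lemma iso_rel_sym : symmetric iso_rel.
Proof.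
by move=> X Y; apply/asboolP/asboolP; exact: gset_iso_sym.
Qed.

Lemma iso_rel_trans : transitive iso_rel.
Proof.
move=> Y X Z /asboolP XY /asboolP YZ; apply/asboolP.
exact: gset_iso_trans XY YZ.
Qed.

Canonical iso_equiv := EquivRel iso_rel iso_rel_refl iso_rel_sym iso_rel_trans.

Definition burnside_rig : Type := {eq_quot iso_equiv}.
HB.instance Definition _ := Choice.on burnside_rig.

Definition iso_class (X : fin_gset G) : burnside_rig :=
  \pi_({eq_quot iso_equiv}) (X : {classic fin_gset G}).

Definition iso_repr (u : burnside_rig) : fin_gset G :=
  repr (u : {eq_quot iso_equiv}).

Lemma iso_reprK u : iso_class (iso_repr u) = u.
Proof. exact: reprK. Qed.

Lemma iso_classP (X Y : fin_gset G) :
  iso_class X = iso_class Y <-> gset_iso X Y.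
Proof.
split=> [/eqmodP/asboolP //|XY].
by apply/eqmodP/asboolP.
Qed.

Lemma iso_repr_class X : gset_iso (iso_repr (iso_class X)) X.
Proof. by apply/iso_classP; rewrite iso_reprK. Qed.

Definition rig_add (u v : burnside_rig) : burnside_rig :=
  iso_class (fin_gset_sum (iso_repr u) (iso_repr v)).

Definition rig_mul (u v : burnside_rig) : burnside_rig :=
  iso_class (fin_gset_prod (iso_repr u) (iso_repr v)).

Lemma rig_add_class X Y :
  rig_add (iso_class X) (iso_class Y) = iso_class (fin_gset_sum X Y).
Proof.
by apply/iso_classP/gset_sum_iso; exact: iso_repr_class.
Qed.

Lemma rig_mul_class X Y :
  rig_mul (iso_class X) (iso_class Y) = iso_class (fin_gset_prod X Y).
Proof.
by apply/iso_classP/gset_prod_iso; exact: iso_repr_class.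
Qed.

Lemma rig_addA : associative rig_add.
Proof.
move=> u v w; rewrite -(iso_reprK u) -(iso_reprK v) -(iso_reprK w).
by rewrite !rig_add_class; apply/iso_classP/gset_sumA.
Qed.

Lemma rig_addC : commutative rig_add.
Proof.
move=> u v; rewrite -(iso_reprK u) -(iso_reprK v).
by rewrite !rig_add_class; apply/iso_classP/gset_sumC.
Qed.

Lemma rig_add0 : left_id (iso_class (fin_gset_empty G)) rig_add.
Proof.
move=> u; rewrite -(iso_reprK u) rig_add_class.
exact/iso_classP/gset_sum0.
Qed.

Lemma rig_mulA : associative rig_mul.
Proof.
move=> u v w; rewrite -(iso_reprK u) -(iso_reprK v) -(iso_reprK w).
by rewrite !rig_mul_class; apply/iso_classP/gset_prodA.
Qed.

Lemma rig_mulC : commutative rig_mul.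
Proof.
move=> u v; rewrite -(iso_reprK u) -(iso_reprK v).
by rewrite !rig_mul_class; apply/iso_classP/gset_prodC.
Qed.

Lemma rig_mul1 : left_id (iso_class (fin_gset_unit G)) rig_mul.
Proof.
move=> u; rewrite -(iso_reprK u) rig_mul_class.
exact/iso_classP/gset_prod1.
Qed.

Lemma rig_mulDl : left_distributive rig_mul rig_add.
Proof.
move=> u v w; rewrite -(iso_reprK u) -(iso_reprK v) -(iso_reprK w).
rewrite (rig_add_class (iso_repr u)) !rig_mul_class rig_add_class.
exact/iso_classP/gset_prodDl.
Qed.

Lemma rig_mul0 : left_zero (iso_class (fin_gset_empty G)) rig_mul.
Proof.
move=> u; rewrite -(iso_reprK u) rig_mul_class.
exact/iso_classP/gset_prod0.
Qed.

(* The rig, hence its Grothendieck ring, is trivial when G has no object, so  *)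
(* only the possibly trivial (Pz) structures are available.                   *)
HB.instance Definition _ :=
  GRing.isNmodule.Build burnside_rig rig_addA rig_addC rig_add0.
HB.instance Definition _ := GRing.Nmodule_isComPzSemiRing.Build burnside_rig
  rig_mulA rig_mulC rig_mul1 rig_mulDl rig_mul0.

End BurnsideRig.

Section GrothendieckRing.
Variable S : comPzSemiRingType.
Implicit Types p q r : S * S.

Definition groth_rel p q : bool :=
  `[< exists e, p.1 + q.2 + e = q.1 + p.2 + e >].

Lemma groth_rel_refl : reflexive groth_rel.
Proof. by move=> p; apply/asboolP; exists 0. Qed.

Lemma groth_rel_sym : symmetric groth_rel.
Proof.
by move=> p q; apply/asboolP/asboolP=> -[e E]; exists e; rewrite E.
Qed.

Lemma groth_rel_trans : transitive groth_rel.
Proof.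
move=> q p r /asboolP[e E] /asboolP[f F]; apply/asboolP.
exists (q.1 + q.2 + e + f).
transitivity ((p.1 + q.2 + e) + (q.1 + r.2 + f)); first by ring.
by rewrite E F; ring.
Qed.

Canonical groth_equiv :=
  EquivRel groth_rel groth_rel_refl groth_rel_sym groth_rel_trans.

Definition grothendieck : Type := {eq_quot groth_equiv}.
HB.instance Definition _ := Choice.on grothendieck.

Definition groth_class (a b : S) : grothendieck :=
  \pi_({eq_quot groth_equiv}) (a, b).

Definition groth_repr (u : grothendieck) : S * S :=
  repr (u : {eq_quot groth_equiv}).

Lemma groth_reprK u : groth_class (groth_repr u).1 (groth_repr u).2 = u.
Proof. by rewrite /groth_class -surjective_pairing; exact: reprK. Qed.

Lemma groth_classP a b c d :
  groth_class a b = groth_class c d <-> exists e, a + d + e = c + b + e.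
Proof.
split=> [/eqmodP/asboolP //|E].
by apply/eqmodP/asboolP.
Qed.

Lemma groth_repr_class a b : exists e,
  (groth_repr (groth_class a b)).1 + b + e =
  a + (groth_repr (groth_class a b)).2 + e.
Proof. by apply/groth_classP; rewrite groth_reprK. Qed.

Definition groth_add (u v : grothendieck) : grothendieck :=
  let p := groth_repr u in let q := groth_repr v in
  groth_class (p.1 + q.1) (p.2 + q.2).

Definition groth_opp (u : grothendieck) : grothendieck :=
  groth_class (groth_repr u).2 (groth_repr u).1.

Definition groth_mul (u v : grothendieck) : grothendieck :=
  let p := groth_repr u in let q := groth_repr v in
  groth_class (p.1 * q.1 + p.2 * q.2) (p.1 * q.2 + p.2 * q.1).

Lemma groth_addE a b c d :
  groth_add (groth_class a b) (groth_class c d) = groth_class (a + c) (b + d).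
Proof.
rewrite /groth_add /=; apply/groth_classP.
have [e E] := groth_repr_class a b; have [f F] := groth_repr_class c d.
move: (groth_repr (groth_class a b)) E => p E.
move: (groth_repr (groth_class c d)) F => q F; exists (e + f).
transitivity ((p.1 + b + e) + (q.1 + d + f)); first by ring.
by rewrite E F; ring.
Qed.

Lemma groth_oppE a b : groth_opp (groth_class a b) = groth_class b a.
Proof.
apply/groth_classP; have [e E] := groth_repr_class a b; exists e.
by rewrite [X in X + e]addrC -E [X in X + e]addrC.
Qed.

Lemma groth_mulE a b c d :
  groth_mul (groth_class a b) (groth_class c d) =
  groth_class (a * c + b * d) (a * d + b * c).
Proof.
rewrite /groth_mul /=.
have [e E] := groth_repr_class a b; have [f F] := groth_repr_class c d.
move: (groth_repr (groth_class a b)) E => p E.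
move: (groth_repr (groth_class c d)) F => q F.
transitivity (groth_class (a * q.1 + b * q.2) (a * q.2 + b * q.1)).
- apply/groth_classP; exists (e * q.1 + e * q.2).
  transitivity ((p.1 + b + e) * q.1 + (a + p.2 + e) * q.2); first by ring.
  by rewrite -E; rewrite {1}E; ring.
- apply/groth_classP; exists (a * f + b * f).
  transitivity (a * (q.1 + d + f) + b * (c + q.2 + f)); first by ring.
  by rewrite -F; rewrite {1}F; ring.
Qed.

Lemma groth_ind (P : grothendieck -> Prop) :
  (forall a b, P (groth_class a b)) -> forall u, P u.
Proof. by move=> PP u; rewrite -(groth_reprK u). Qed.

Lemma groth_addA : associative groth_add.
Proof.
elim/groth_ind=> a b; elim/groth_ind=> c d; elim/groth_ind=> e f.
by rewrite !groth_addE !addrA.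
Qed.

Lemma groth_addC : commutative groth_add.
Proof.
elim/groth_ind=> a b; elim/groth_ind=> c d.
by rewrite !groth_addE (addrC a) (addrC b).
Qed.

Lemma groth_add0 : left_id (groth_class 0 0) groth_add.
Proof. by elim/groth_ind=> a b; rewrite groth_addE !add0r. Qed.

Lemma groth_addN : left_inverse (groth_class 0 0) groth_opp groth_add.
Proof.
elim/groth_ind=> a b; rewrite groth_oppE groth_addE; apply/groth_classP.
by exists 0; ring.
Qed.

Lemma groth_mulA : associative groth_mul.
Proof.
elim/groth_ind=> a b; elim/groth_ind=> c d; elim/groth_ind=> e f.
by rewrite !groth_mulE; congr groth_class; ring.
Qed.

Lemma groth_mulC : commutative groth_mul.
Proof.
elim/groth_ind=> a b; elim/groth_ind=> c d.
by rewrite !groth_mulE; congr groth_class; ring.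
Qed.

Lemma groth_mul1 : left_id (groth_class 1 0) groth_mul.
Proof.
by elim/groth_ind=> a b; rewrite groth_mulE; congr groth_class; ring.
Qed.

Lemma groth_mulDl : left_distributive groth_mul groth_add.
Proof.
elim/groth_ind=> a b; elim/groth_ind=> c d; elim/groth_ind=> e f.
by rewrite (groth_addE a b) !groth_mulE groth_addE; congr groth_class; ring.
Qed.

HB.instance Definition _ := GRing.isZmodule.Build grothendieck
  groth_addA groth_addC groth_add0 groth_addN.
HB.instance Definition _ := GRing.Zmodule_isComPzRing.Build grothendieck
  groth_mulA groth_mulC groth_mul1 groth_mulDl.

End GrothendieckRing.

Notation burnside_ring G := (grothendieck (burnside_rig G)).

Section OneObjectSubgroupoids.
Variable G : groupoid.

Record subgroupoid1 := Subgroupoid1 {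
  sub_obj : obj G;
  sub_arr : set (arr G);
  sub_isotropy : forall g, sub_arr g -> src g = sub_obj /\ tgt g = sub_obj;
  sub_ident : sub_arr (ident sub_obj);
  sub_inv : forall g, sub_arr g -> sub_arr (inv g);
  sub_comp : forall g h (e : src g = tgt h),
    sub_arr g -> sub_arr h -> sub_arr (comp e)
}.

(* k = d h d^-1. *)
Definition conj_arr (d h k : arr G) : Prop :=
  exists (e : src d = tgt h) (e' : src (comp e) = tgt (inv d)), k = comp e'.

Definition conjugated (H K : subgroupoid1) : Prop :=
  exists d, [/\ src d = sub_obj H, tgt d = sub_obj K
    & sub_arr K = [set k | exists2 h, sub_arr H h & conj_arr d h k]].

Definition conj_representatives (R : set subgroupoid1) : Prop :=
  forall H, exists! K, R K /\ conjugated H K.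

End OneObjectSubgroupoids.

Definition fixed_points (G : groupoid) (X : gset G) (H : subgroupoid1 G) :
    set X :=
  [set x | anchor x = sub_obj H /\
    forall h (e : anchor x = tgt h), sub_arr H h -> act e = x].
Arguments fixed_points {G} X H.

Definition num_fixed_points (G : groupoid) (X : fin_gset G)
    (H : subgroupoid1 G) : nat :=
  #|` fset_set (fixed_points X H : set {classic X})|%fset.

(* Main.v *)
Require Import Defs.
From HB Require Import structures.
From mathcomp Require Import all_boot all_order all_algebra finmap.
From mathcomp Require Import ring boolp classical_sets functions cardinality.

Import GRing.Theory.
Local Open Scope ring_scope.

(** The map X |-> |X^H| is additive for disjoint unions, multiplicative for
    fibered products, invariant under isomorphism, and takes the value 1 on the
    unit, since the only object fixed by H is the object of H. It is therefore
    a morphism of rigs, and it extends to the Grothendieck ring by differences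
    ([groth_lift]).

    Injectivity is Burnside's theorem for groupoids ([same_marks_iso]): finite
    G-sets X and Y with |X^H| = |Y^H| for all H are isomorphic. It suffices to
    know the equality on representatives, because an arrow conjugating H to K
    acts as a bijection between X^K and X^H ([num_fixed_conj]). The isotropy
    groups may be infinite, so the usual triangular table of marks, ordered by
    the sizes of subgroups, is replaced by an induction on |X| + |Y|. Take x
    with an orbit of least cardinal among all orbits of X and Y, say in X. Its
    stabilizer S fixes x, hence fixes some y in Y, and x g |-> y g is then a
    well defined morphism from the orbit of x onto the orbit of y. By
    minimality the orbit of y is not smaller than that of x, so this morphism
    is an isomorphism ([orbit_iso], [common_summand]). Removing the two
    orbits leaves smaller G-sets whose marks still agree.

    Finally, if [a, b] and [c, d] have the same image then a + d and c + b have
    the same marks, so a + d = c + b already in the rig. *)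

Set Implicit Arguments.
Unset Strict Implicit.
Unset Printing Implicit Defensive.
Local Open Scope classical_set_scope.

Local Notation comp := Defs.comp.
Local Notation inv := Defs.inv.

(** * Cardinals of finite sets in arbitrary types *)

Definition ncard (T : Type) (A : set T) : nat :=
  #|` fset_set (A : set {classic T})|%fset.

Lemma ncard0 (T : Type) : ncard (set0 : set T) = 0%N.
Proof. by rewrite /ncard fset_set0 cardfs0. Qed.

Lemma ncard1 (T : Type) (x : T) : ncard [set x] = 1%N.
Proof. by rewrite /ncard (fset_set1 (x : {classic T})) cardfs1. Qed.

Lemma ncard_gt0 (T : Type) (A : set T) (x : T) :
  finite_set A -> A x -> (0 < ncard A)%N.
Proof.
move=> finA Ax; rewrite /ncard cardfs_gt0; apply/eqP => /fset_set_set0.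
by move=> /(_ finA) A0; rewrite A0 in Ax.
Qed.

Lemma ncard_gt0_ex (T : Type) (A : set T) : (0 < ncard A)%N -> exists x, A x.
Proof.
move=> A_gt0; apply: contrapT => nA; move: A_gt0.
rewrite (_ : A = set0) ?ncard0 //.
by apply/seteqP; split=> // x Ax; case: nA; exists x.
Qed.

Lemma ncard_image (T U : Type) (f : T -> U) (A : set T) : finite_set A ->
  {in A &, injective f} -> ncard (f @` A) = ncard A.
Proof.
move=> finA f_inj; have finfA : finite_set (f @` A) by exact: finite_image.
apply/(@fcard_eq {classic U} {classic T} _ _ finfA finA).
exact: (inj_card_eq f_inj).
Qed.

Lemma ncard_le_eq (T : Type) (A B : set T) : finite_set B -> A `<=` B ->
  (ncard B <= ncard A)%N -> A = B.
Proof.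
move=> finB AB leBA; have finA := sub_finite_set AB finB.
apply: (@fset_set_inj {classic T}) => //; apply/eqP.
have AB' : (fset_set (A : set {classic T}) `<=` fset_set (B : set {classic T}))%fset.
  by rewrite -fset_set_sub.
by rewrite eqEfcard AB'.
Qed.

Lemma ncardU (T : Type) (A B : set T) : finite_set A -> finite_set B ->
  A `&` B = set0 -> ncard (A `|` B) = (ncard A + ncard B)%N.
Proof.
move=> finA finB AB0; have /= := cardfsUI
  (fset_set (A : set {classic T})) (fset_set (B : set {classic T})).
rewrite -fset_setU // -fset_setI //.
by rewrite (_ : (A : set {classic T}) `&` B = set0) // fset_set0 cardfs0 addn0.
Qed.

Lemma ncardX (T U : Type) (A : set T) (B : set U) : finite_set A ->
  finite_set B -> ncard (A `*` B) = (ncard A * ncard B)%N.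
Proof.
move=> finA finB; rewrite /ncard.
pose s := [seq (x, y) | x <- enum_fset (fset_set (A : set {classic T})),
                        y <- enum_fset (fset_set (B : set {classic U}))].
have s_uniq : uniq s by apply: allpairs_uniq => //= -[? ?] [? ?] _ _ [-> ->].
rewrite -(size_allpairs (@pair {classic T} {classic U})) -/s -(undup_id s_uniq).
rewrite -card_fseq.
have finAB : finite_set (A `*` B) by exact: finite_setX.
pose AB : set ({classic T} * {classic U})%type := A `*` B.
have -> : [fset x | x in s]%fset = fset_set AB.
  apply/fsetP => -[x y]; rewrite in_fset_set // !inE /=.
  apply/idP/idP => [/allpairsP[[x' y'] /= [Ax By [-> ->]]]|].
    by apply/mem_set; split=> /=; apply/set_mem; rewrite -in_fset_set.
  move=> /set_mem[/= Ax By]; apply/allpairsP; exists (x, y).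
  by split=> //=; rewrite in_fset_set //; exact/mem_set.
apply/(@fcard_eq {classic (T * U)} ({classic T} * {classic U})%type _ AB finAB finAB).
exact: card_eqxx.
Qed.

(** A section of f is injective, so by the comparison of cardinals its image
    is the whole source; hence the section is a two-sided inverse of f. *)
Lemma surj_bijective (T U : Type) (f : T -> U) : finite_set [set: T] ->
  (ncard [set: T] <= ncard [set: U])%N -> (forall y, exists x, f x = y) ->
  bijective f.
Proof.
move=> finT leTU /choice[s sK].
have s_inj : injective s by exact: can_inj sK.
have finU : finite_set [set: U].
  apply: sub_finite_set (finite_image f finT) => y _.
  by exists (s y).
have sT : s @` [set: U] = [set: T].
  by apply: ncard_le_eq => //; rewrite ncard_image // => x y _ _; exact: s_inj.
exists s => // x.
have [y _ <-] : (s @` [set: U]) x by rewrite sT.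
by rewrite sK.
Qed.

Lemma sval_injective (T : Type) (A : set T) : injective (@sval T A).
Proof.
by move=> [x Ax] [y Ay] /= xy; subst y; rewrite (Prop_irrelevance Ax Ay).
Qed.

Lemma ncard_sig (T : Type) (A : set T) : finite_set A ->
  ncard [set: {x | A x}] = ncard A.
Proof.
move=> finA.
have valT : (@sval T A) @` setT = A.
  apply/seteqP; split=> [_ [[x Ax] _ <-] //|x Ax].
  by exists (exist _ x Ax).
rewrite -[RHS](congr1 (@ncard T) valT) ncard_image //; last first.
  by move=> x y _ _; exact: sval_injective.
rewrite -(preimage_setT (@sval T A)) -[X in finite_set X]setIid.
rewrite (_ : _ `&` _ = (@sval T A) @^-1` A).
  by apply: finite_preimage => // x y _ _; exact: sval_injective.
by apply/seteqP; split=> // -[x Ax].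
Qed.

(** * The action as a relation *)

Section Moves.
Variable G : groupoid.

(** The action is partial, so that a composite of two actions carries proofs of
    composability; as a ternary relation it is free of them. *)
Definition moves (X : gset G) (x : X) (g : arr G) (y : X) : Prop :=
  exists e : anchor x = tgt g, act e = y.

Variable X : gset G.
Implicit Types (x y z : X) (g h : arr G).

Lemma moves_act x g (e : anchor x = tgt g) : moves x g (act e).
Proof. by exists e. Qed.

Lemma moves_ex x g : anchor x = tgt g -> exists y, moves x g y.
Proof. by move=> e; exists (act e); exact: moves_act. Qed.

Lemma moves_tgt x g y : moves x g y -> anchor x = tgt g.
Proof. by case. Qed.

Lemma moves_src x g y : moves x g y -> anchor y = src g.
Proof. by case=> e <-; exact: anchor_act. Qed.

Lemma moves_fun x g y z : moves x g y -> moves x g z -> y = z.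
Proof. by move=> [e <-] [e' <-]; exact: act_irr. Qed.

Lemma moves_actE x g y (e : anchor x = tgt g) : moves x g y -> act e = y.
Proof. by apply: moves_fun; exact: moves_act. Qed.

Lemma moves_ident x : moves x (ident (anchor x)) x.
Proof.
have e : anchor x = tgt (ident (anchor x)) by rewrite tgt_ident.
by exists e; exact: act_ident.
Qed.

Lemma moves_comp x g y h z (e : src g = tgt h) :
  moves x g y -> moves y h z -> moves x (comp e) z.
Proof.
move=> [e1 <-] [e2 <-].
have e4 : anchor x = tgt (comp e) by rewrite tgt_comp.
by exists e4; rewrite (act_comp e2 e4).
Qed.

Lemma moves_comp_ex x g y h z :
  moves x g y -> moves y h z -> exists k, moves x k z.
Proof.
move=> xy yz; have e : src g = tgt h by rewrite -(moves_src xy) (moves_tgt yz).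
by exists (comp e); exact: moves_comp xy yz.
Qed.

Lemma moves_inv x g y : moves x g y -> moves y (inv g) x.
Proof.
move=> xy; have e : src g = tgt (inv g) by rewrite tgt_inv.
have [|z yz] := @moves_ex y (inv g); first by rewrite (moves_src xy).
have := moves_comp e xy yz; rewrite comp_inv_r -(moves_tgt xy) => xz.
by rewrite (moves_fun (moves_ident x) xz).
Qed.

Lemma moves_inj x y g z : moves x g z -> moves y g z -> x = y.
Proof. by move=> /moves_inv zx /moves_inv zy; exact: moves_fun zx zy. Qed.

End Moves.

Lemma morphism_moves (G : groupoid) (X Y : gset G) (f : X -> Y) x g y :
  gset_morphism f -> moves x g y -> moves (f x) g (f y).
Proof.
move=> [fa fg] [e <-].
have e' : anchor (f x) = tgt g by rewrite fa.
by exists e'; rewrite (fg _ _ e e').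
Qed.

Lemma moves_morphism (G : groupoid) (X Y : gset G) (f : X -> Y) :
  (forall x, anchor (f x) = anchor x) ->
  (forall x g y, moves x g y -> moves (f x) g (f y)) -> gset_morphism f.
Proof.
move=> fa fm; split=> // x g e e'.
by symmetry; apply: moves_actE; apply: fm; exact: moves_act.
Qed.

(** * Invariant subsets and orbits *)

Section Orbits.
Variables (G : groupoid) (X : gset G).

Definition invariant (A : set X) : Prop :=
  forall x g y, moves x g y -> A x -> A y.

Lemma invariantC (A : set X) : invariant A -> invariant (~` A).
Proof. by move=> iA x g y /moves_inv yx nAx /(iA _ _ _ yx). Qed.

Definition gset_sub (A : set X) (iA : invariant A) : gset G.
Proof.
refine (@GSet G {x | A x} (fun p => anchor (sval p))
  (fun p g e => exist _ (act e) (iA _ _ _ (moves_act e) (svalP p))) _ _ _).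
- by move=> p g e; exact: anchor_act.
- by move=> [x Ax] e; apply: sval_injective => /=; exact: act_ident.
- by move=> [x Ax] g h e1 e2 e3 e4; apply: sval_injective => /=; exact: act_comp.
Defined.

Lemma gset_sub_moves (A : set X) (iA : invariant A) (p q : gset_sub iA) g :
  moves p g q <-> moves (sval p) g (sval q).
Proof.
split=> [[e <-]|[e pq]]; first exact: moves_act.
by exists e; apply: sval_injective.
Qed.

(** Invertibility of arrows makes complements of invariant subsets invariant;
    this is what allows a G-set to be cut along an orbit. *)
Lemma gset_split (A : set X) (iA : invariant A) :
  gset_iso X (gset_sum (gset_sub iA) (gset_sub (invariantC iA))).
Proof.
apply: gset_iso_sym.
pose f (u : gset_sum (gset_sub iA) (gset_sub (invariantC iA))) : X :=
  match u with inl p => sval p | inr p => sval p end.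
pose f' x : gset_sum (gset_sub iA) (gset_sub (invariantC iA)) :=
  match pselect (A x) with
  | left Ax => inl (exist _ x Ax)
  | right nAx => inr (exist _ x nAx)
  end.
apply: (@gset_isoI _ _ _ f f').
- by split=> [[p|p]|[p|p] g e e'] //=; exact: act_irr.
- case=> -[x Ax]; rewrite /f' /=; case: pselect => // Ax'.
    by rewrite (Prop_irrelevance Ax Ax').
  by rewrite (Prop_irrelevance Ax Ax').
- by move=> x; rewrite /f'; case: pselect.
Qed.

Definition orbit (x : X) : set X := [set y | exists g, moves x g y].

Lemma orbit_refl x : orbit x x.
Proof. by exists (ident (anchor x)); exact: moves_ident. Qed.

Lemma orbit_invariant x : invariant (orbit x).
Proof. by move=> y g z yz [h xy]; exact: moves_comp_ex xy yz. Qed.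

(** The point x is fixed by this subgroupoid, whose mark is therefore positive
    on every G-set that contains x. *)
Definition stabilizer (x : X) : subgroupoid1 G.
Proof.
refine (@Subgroupoid1 G (anchor x) [set g | moves x g x] _ _ _ _).
- by move=> g xx; rewrite -(moves_src xx) -(moves_tgt xx).
- exact: moves_ident.
- by move=> g; exact: moves_inv.
- by move=> g h e; exact: moves_comp.
Defined.

Lemma fixed_pointsP (x : X) (H : subgroupoid1 G) :
  fixed_points X H x <->
  anchor x = sub_obj H /\ forall h, sub_arr H h -> moves x h x.
Proof.
split=> -[ax xH]; split=> // h.
- move=> Hh; have [_ th] := sub_isotropy Hh.
  have e : anchor x = tgt h by rewrite ax th.
  by exists e; exact: xH.
- by move=> e /xH; exact: moves_actE.
Qed.

Lemma fixed_stabilizer x : fixed_points X (stabilizer x) x.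
Proof. exact/fixed_pointsP. Qed.

End Orbits.

Lemma finite_subset_gset (G : groupoid) (X : fin_gset G) (A : set X) :
  finite_set A.
Proof. exact: sub_finite_set (finite_car X). Qed.

Definition fin_gset_sub (G : groupoid) (X : fin_gset G) (A : set X)
  (iA : invariant A) : fin_gset G.
Proof.
refine (@FinGSet G (gset_sub iA) _).
rewrite -(preimage_setT (@sval X A)).
apply: finite_preimage; last exact: finite_car.
by move=> p q _ _; exact: sval_injective.
Defined.

(** If y is fixed by the stabilizer of x then x g |-> y g is a well defined
    morphism of the orbit of x onto the orbit of y; a comparison of cardinals
    makes it an isomorphism. *)
Lemma orbit_iso (G : groupoid) (X Y : fin_gset G) (x : X) (y : Y)
    (ix : invariant (orbit x)) (iy : invariant (orbit y)) :
  fixed_points Y (stabilizer x) y -> (ncard (orbit x) <= ncard (orbit y))%N ->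
  gset_iso (gset_sub ix) (gset_sub iy).
Proof.
move=> /fixed_pointsP[/= ay yS] le_xy.
set O := gset_sub ix; set O' := gset_sub iy.
(* If x g = x h then g h^-1 stabilizes x, hence fixes y, hence y g = y h. *)
have wd g h x' y' y'' : moves x g x' -> moves x h x' ->
    moves y g y' -> moves y h y'' -> y' = y''.
  move=> xg xh yg yh.
  have e : src g = tgt (inv h).
    by rewrite tgt_inv -(moves_src xg) -(moves_src xh).
  have /yS ygh := moves_comp e xg (moves_inv xh).
  have [|z y'z] := @moves_ex _ _ y' (inv h).
    by rewrite (moves_src yg) -e.
  have yz := moves_comp e yg y'z.
  have zy := moves_fun ygh yz; rewrite -{}zy in y'z.
  exact: moves_inj y'z (moves_inv yh).
have orbit_map (p : O) : exists q : O', exists g,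
    moves x g (sval p) /\ moves y g (sval q).
  case: (svalP p) => g xg.
  have [|y' yg] := @moves_ex _ _ y g; first by rewrite ay (moves_tgt xg).
  by exists (exist _ y' (ex_intro _ g yg)), g.
have [f fP] := choice orbit_map.
have f_surj (q : O') : exists p, f p = q.
  case: (svalP q) => g yg.
  have [|x' xg] := @moves_ex _ _ x g; first by rewrite -ay (moves_tgt yg).
  pose p : O := exist _ x' (ex_intro _ g xg).
  exists p; have [h [xh yh]] := fP p.
  exact: sval_injective (wd h g x' _ _ xh xg yh yg).
have f_morph : gset_morphism f.
  apply: moves_morphism => [p|p g q pq].
    by have [h [xh yh]] := fP p; rewrite /= (moves_src xh) (moves_src yh).
  have [h [xh yh]] := fP p; have [k [xk yk]] := fP q.
  move/gset_sub_moves in pq; apply/gset_sub_moves.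
  have e : src h = tgt g by rewrite -(moves_src xh) (moves_tgt pq).
  have [|z pz] := @moves_ex _ _ (sval (f p)) g; first by rewrite (moves_src yh).
  by rewrite (wd _ _ _ _ _ xk (moves_comp e xh pq) yk (moves_comp e yh pz)).
have [|||f' fK f'K] := @surj_bijective O O' f.
- exact: (finite_car (fin_gset_sub ix)).
- by rewrite !ncard_sig //; exact: finite_subset_gset.
- by [].
exact: gset_isoI f_morph fK f'K.
Qed.

(** * Numbers of fixed points *)

Section Marks.
Variable G : groupoid.
Implicit Types (X Y : fin_gset G) (H K : subgroupoid1 G).

Lemma num_fixed_pointsE X H : num_fixed_points X H = ncard (fixed_points X H).
Proof. by []. Qed.

Lemma iso_card X Y : gset_iso X Y -> ncard [set: X] = ncard [set: Y].
Proof.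
case=> f [f' [_ _ fK f'K]].
have -> : [set: Y] = f @` [set: X].
  by apply/seteqP; split=> // y _; exists (f' y).
rewrite ncard_image //; first exact: finite_car.
by move=> x y _ _; exact: can_inj fK _ _.
Qed.

Lemma num_fixed_iso X Y H :
  gset_iso X Y -> num_fixed_points X H = num_fixed_points Y H.
Proof.
case=> f [f' [fM f'M fK f'K]]; rewrite !num_fixed_pointsE.
have fixM (Z T : fin_gset G) (k : Z -> T) z : gset_morphism k ->
    fixed_points Z H z -> fixed_points T H (k z).
  move=> kM /fixed_pointsP[az zH]; apply/fixed_pointsP.
  split; first by rewrite (proj1 kM).
  by move=> h /zH; exact: morphism_moves.
have -> : fixed_points Y H = f @` fixed_points X H.
  apply/seteqP; split=> [y yH|_ [x xH <-]]; last exact: fixM.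
  by exists (f' y) => //; exact: fixM.
rewrite ncard_image //; first exact: finite_subset_gset.
by move=> x y _ _; exact: can_inj fK _ _.
Qed.

Lemma sum_card X Y :
  ncard [set: fin_gset_sum X Y] = (ncard [set: X] + ncard [set: Y])%N.
Proof.
have -> : [set: fin_gset_sum X Y] = inl @` [set: X] `|` inr @` [set: Y].
  by apply/seteqP; split=> // -[x|y] _; [left; exists x|right; exists y].
rewrite ncardU ?ncard_image //; try by exact: finite_car.
- by move=> ? ? _ _ [].
- by move=> ? ? _ _ [].
- by apply: finite_image; exact: finite_car.
- by apply: finite_image; exact: finite_car.
- by apply/seteqP; split=> // u [[x _ <-] [y _]].
Qed.

Lemma num_fixed_sum X Y H : num_fixed_points (fin_gset_sum X Y) H =
  (num_fixed_points X H + num_fixed_points Y H)%N.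
Proof.
rewrite !num_fixed_pointsE.
have -> : fixed_points (fin_gset_sum X Y) H =
    inl @` fixed_points X H `|` inr @` fixed_points Y H.
  apply/seteqP; split.
    move=> [x|y] [/= ax xH]; [left; exists x => //|right; exists y => //].
      by split=> // h e Hh; case: (xH h e Hh).
    by split=> // h e Hh; case: (xH h e Hh).
  by move=> _ [[x [ax xH] <-]|[y [ay yH] <-]]; split=> //= h e Hh;
    rewrite ?xH ?yH.
rewrite ncardU ?ncard_image //; try by exact: finite_subset_gset.
- by move=> ? ? _ _ [].
- by move=> ? ? _ _ [].
- by apply/seteqP; split=> // u [[x _ <-] [y _]].
Qed.

Lemma num_fixed_empty H : num_fixed_points (fin_gset_empty G) H = 0%N.
Proof.
rewrite num_fixed_pointsE (_ : fixed_points _ _ = set0) ?ncard0 //.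
by apply/seteqP; split; case.
Qed.

Lemma num_fixed_prod X Y H : num_fixed_points (fin_gset_prod X Y) H =
  (num_fixed_points X H * num_fixed_points Y H)%N.
Proof.
rewrite !num_fixed_pointsE -ncardX; try exact: finite_subset_gset.
have <- : sval @` (fixed_points (fin_gset_prod X Y) H) =
    fixed_points X H `*` fixed_points Y H.
  apply/seteqP; split.
    move=> _ [[[x y] xy] [/= ax xyH] <-] /=; split; split=> //=.
    - by move=> h e Hh; case: (congr1 sval (xyH h e Hh)).
    - by rewrite -xy.
    - move=> h e Hh; have e' : anchor x = tgt h by rewrite xy.
      have /(congr1 snd) /= yh := congr1 sval (xyH h e' Hh).
      by rewrite -[RHS]yh; exact: act_irr.
  move=> [x y] [[/= ax xH] [/= ay yH]].
  have xy : anchor x = anchor y by rewrite ax ay.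
  exists (exist (fun q : X * Y => anchor q.1 = anchor q.2) (x, y) xy) => //.
  by split=> // h e Hh; apply: fprod_inj => /=; rewrite xH ?yH.
rewrite ncard_image //; first exact: finite_subset_gset.
by move=> p q _ _; exact: fprod_inj.
Qed.

(** With K = d H d^-1 on arrows, the action of d^-1 is a bijection from X^H onto
    X^K, whose inverse is the action of d. *)
Lemma num_fixed_conj X H K :
  conjugated H K -> num_fixed_points X H = num_fixed_points X K.
Proof.
move=> [d [dH dK KE]]; rewrite !num_fixed_pointsE.
pose f (x : X) : X :=
  if pselect (anchor x = tgt (inv d)) is left e then act e else x.
have fP x : anchor x = sub_obj H -> moves x (inv d) (f x).
  move=> ax; rewrite /f; case: pselect => [e|]; first exact: moves_act.
  by rewrite tgt_inv dH.
have -> : fixed_points X K = f @` fixed_points X H; last first.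
  rewrite ncard_image //; first exact: finite_subset_gset.
  move=> x y /set_mem[/fP ax _] /set_mem[/fP ay _] xy.
  by rewrite xy in ax; exact: moves_inj ax ay.
apply/seteqP; split=> [y /fixed_pointsP[ay yK]|_ [x /fixed_pointsP[ax xH] <-]].
- have [|x yx] := @moves_ex _ _ y d; first by rewrite ay dK.
  have ax : anchor x = sub_obj H by rewrite (moves_src yx).
  have xy := moves_inv yx.
  exists x; last exact: moves_fun (fP x ax) xy.
  apply/fixed_pointsP; split=> // h Hh; have [sh th] := sub_isotropy Hh.
  have [|z xz] := @moves_ex _ _ x h; first by rewrite ax th.
  have e : src d = tgt h by rewrite dH th.
  have e' : src (comp e) = tgt (inv d) by rewrite src_comp tgt_inv sh dH.
  have [|w zw] := @moves_ex _ _ z (inv d).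
    by rewrite (moves_src xz) tgt_inv sh dH.
  (* y is fixed by d h d^-1, so z d^-1 = y = x d^-1, where z = x h. *)
  have yw := moves_comp e' (moves_comp e yx xz) zw.
  have /yK yy : sub_arr K (comp e') by rewrite KE; exists h => //; exists e, e'.
  rewrite -(moves_fun yy yw) in zw.
  by rewrite -(moves_inj xy zw) in xz.
- apply/fixed_pointsP; split; first by rewrite (moves_src (fP x ax)) src_inv.
  move=> k; rewrite KE => -[h /xH xx [e [e' ->]]].
  (* f x = x d^-1 goes back to x under d, then to x under h. *)
  have fx : moves (f x) d x.
    have xf := fP x ax.
    have [|z xz] := @moves_ex _ _ (f x) d.
      by rewrite (moves_src xf) src_inv.
    have zx : z = x := moves_inj (moves_inv xz) xf.
    by rewrite zx in xz.
  exact: moves_comp (moves_comp e fx xx) (fP x ax).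
Qed.

End Marks.

(** * Marks determine a finite G-set *)

Section MarksDetermine.
Variable G : groupoid.
Implicit Types X Y O : fin_gset G.

Definition same_marks X Y : Prop :=
  forall H, num_fixed_points X H = num_fixed_points Y H.

(** If the orbit of x is no larger than any orbit of Y, then X and Y have a
    common orbit. Indeed x is fixed by its stabilizer S, so that S also fixes
    some y in Y; the orbit of y is an image of that of x, and minimality
    forces the two to be isomorphic. *)
Lemma common_summand X Y (x : X) : same_marks X Y ->
  (forall y : Y, ncard (orbit x) <= ncard (orbit y))%N ->
  exists O X' Y', [/\ (0 < ncard [set: O])%N,
    gset_iso X (fin_gset_sum O X') & gset_iso Y (fin_gset_sum O Y')].
Proof.
move=> XY x_min.
have [y yS] : exists y, fixed_points Y (stabilizer x) y.
  apply: ncard_gt0_ex; rewrite -num_fixed_pointsE -XY num_fixed_pointsE.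
  by apply: ncard_gt0 (fixed_stabilizer x); exact: finite_subset_gset.
have ix := @orbit_invariant _ X x; have iy := @orbit_invariant _ Y y.
exists (fin_gset_sub ix), (fin_gset_sub (invariantC ix)),
  (fin_gset_sub (invariantC iy)); split.
- have xx : [set: fin_gset_sub ix] (exist _ x (orbit_refl x)) by [].
  exact: ncard_gt0 (finite_car _) xx.
- exact: gset_split.
- apply: gset_iso_trans (gset_split iy) _.
  apply: gset_sum_iso; last exact: gset_iso_refl.
  by apply/gset_iso_sym/(orbit_iso _ _ yS).
Qed.

Lemma min_orbit X (x0 : X) :
  exists x : X, forall x' : X, (ncard (orbit x) <= ncard (orbit x'))%N.
Proof.
pose P n := `[< exists x : X, ncard (orbit x) = n >].
have exP : exists n, P n by exists (ncard (orbit x0)); apply/asboolP; exists x0.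
case: (ex_minnP exP) => n /asboolP[x <-] n_min; exists x => x'.
by apply: n_min; apply/asboolP; exists x'.
Qed.

(** Starts the induction: a point of Y is fixed by its own stabilizer, which
    therefore also fixes some point of X. *)
Lemma same_marks_empty X Y : same_marks X Y -> (X -> False) -> Y -> False.
Proof.
move=> XY X0 y; have [|x _] := @ncard_gt0_ex X (fixed_points X (stabilizer y)).
  rewrite -num_fixed_pointsE XY num_fixed_pointsE.
  by apply: ncard_gt0 (fixed_stabilizer y); exact: finite_subset_gset.
exact: X0.
Qed.

(** A common orbit is split off both sides, and cancelling its fixed points
    leaves smaller G-sets with the same marks. An orbit that is smallest in X
    and Y together can be taken in X because the claim is symmetric. *)
Lemma same_marks_iso X Y : same_marks X Y -> gset_iso X Y.
Proof.
have [n] := ubnP (ncard [set: X] + ncard [set: Y]).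
elim: n X Y => // n IHn X Y ltn XY.
have YX : same_marks Y X by move=> H; rewrite XY.
have peel O X' Y' : (0 < ncard [set: O])%N -> gset_iso X (fin_gset_sum O X') ->
    gset_iso Y (fin_gset_sum O Y') -> gset_iso X Y.
  move=> O_gt0 XO YO; suff XY' : gset_iso X' Y'.
    apply: gset_iso_trans XO (gset_iso_trans _ (gset_iso_sym YO)).
    by apply: gset_sum_iso => //; exact: gset_iso_refl.
  apply: IHn => [|H].
    move: ltn; rewrite (iso_card XO) (iso_card YO) !sum_card ltnS.
    apply: leq_trans; rewrite addnACA -[ltnLHS]add0n ltn_add2r.
    by rewrite addn_gt0 O_gt0.
  apply/eqP; rewrite -(eqn_add2l (num_fixed_points O H)) -!num_fixed_sum.
  by rewrite -(num_fixed_iso H XO) -(num_fixed_iso H YO) XY.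
have [[x0]|X0] := pselect (exists x0 : X, True); last first.
  have nX (x : X) : False by apply: X0; exists x.
  have nY := same_marks_empty XY nX.
  apply: (@gset_isoI _ X Y (fun x => False_rect _ (nX x))
    (fun y => False_rect _ (nY y))).
  - by split=> x; case: (nX x).
  - by move=> x; case: (nX x).
  - by move=> y; case: (nY y).
have [y0|nY] := pselect (exists y0 : Y, True); last first.
  move=> _; exfalso; apply: (same_marks_empty YX _ x0) => y.
  by apply: nY; exists y.
move=> _; case: y0 => y0 _.
have [x x_min] := min_orbit x0; have [y y_min] := min_orbit y0.
have [le_xy|/ltnW le_yx] := leqP (ncard (orbit x)) (ncard (orbit y)).
  have [|O [X' [Y' [O_gt0 XO YO]]]] := @common_summand X Y x XY.
    by move=> y'; exact: leq_trans le_xy (y_min y').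
  exact: peel O_gt0 XO YO.
have [|O [Y' [X' [O_gt0 YO XO]]]] := @common_summand Y X y YX.
  by move=> x'; exact: leq_trans le_yx (x_min x').
exact: peel O_gt0 XO YO.
Qed.

End MarksDetermine.

(** * The ghost map *)

Section GrothendieckLift.
Variables (S : comPzSemiRingType) (R : comPzRingType) (f : {rmorphism S -> R}).

Definition groth_lift (u : grothendieck S) : R :=
  f (groth_repr u).1 - f (groth_repr u).2.

(** The chosen representatives of a class satisfy their relation only up to a
    summand e, whose image f e cancels in the ring R. *)
Lemma groth_liftE a b : groth_lift (groth_class a b) = f a - f b.
Proof.
have [e /(congr1 f)] := groth_repr_class a b; rewrite !rmorphD => /addIr E.
by apply/eqP; rewrite /groth_lift subr_eq addrAC eq_sym subr_eq E.
Qed.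

Fact groth_lift_zmod : zmod_morphism groth_lift.
Proof.
elim/groth_ind=> a b; elim/groth_ind=> c d.
have -> : groth_class a b - groth_class c d = groth_class (a + d) (b + c).
  by rewrite -[- _]/(groth_opp _) groth_oppE -[LHS]/(groth_add _ _) groth_addE.
by rewrite !groth_liftE !rmorphD; ring.
Qed.

Fact groth_lift_monoid : monoid_morphism groth_lift.
Proof.
split; first by rewrite -[1]/(groth_class 1 0) groth_liftE rmorph1 rmorph0 subr0.
elim/groth_ind=> a b; elim/groth_ind=> c d.
rewrite -[_ * _]/(groth_mul _ _) groth_mulE !groth_liftE !rmorphD !rmorphM.
by ring.
Qed.

HB.instance Definition _ :=
  GRing.isZmodMorphism.Build _ _ groth_lift groth_lift_zmod.
HB.instance Definition _ :=
  GRing.isMonoidMorphism.Build _ _ groth_lift groth_lift_monoid.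

End GrothendieckLift.

Section RigMarks.
Variables (G : fin_groupoid) (I : set (subgroupoid1 G)).

Definition rig_marks (u : burnside_rig G) : I -> int :=
  fun H => (num_fixed_points (iso_repr u) (val H))%:Z.

Lemma rig_marksE (X : fin_gset G) H :
  rig_marks (iso_class X) H = (num_fixed_points X (val H))%:Z.
Proof. by rewrite /rig_marks (num_fixed_iso _ (iso_repr_class X)). Qed.

Lemma num_fixed_unit (H : subgroupoid1 G) :
  num_fixed_points (fin_gset_unit G) H = 1%N.
Proof.
rewrite num_fixed_pointsE.
have -> : fixed_points (fin_gset_unit G) H = [set sub_obj H].
  apply/seteqP; split=> [a [] //|_ ->]; split=> //= h e.
  by case/sub_isotropy.
exact: ncard1.
Qed.

Fact rig_marks_nmod : nmod_morphism rig_marks.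
Proof.
split=> [|u v]; apply/funext => H.
  by rewrite -[0]/(iso_class (fin_gset_empty G)) rig_marksE num_fixed_empty.
rewrite -(iso_reprK u) -(iso_reprK v) -[_ + _ in LHS]/(rig_add _ _).
by rewrite rig_add_class -[RHS]/(rig_marks _ H + rig_marks _ H) !rig_marksE num_fixed_sum PoszD.
Qed.

Fact rig_marks_monoid : monoid_morphism rig_marks.
Proof.
split=> [|u v]; apply/funext => H.
  by rewrite -[1]/(iso_class (fin_gset_unit G)) rig_marksE num_fixed_unit.
rewrite -(iso_reprK u) -(iso_reprK v) -[_ * _ in LHS]/(rig_mul _ _).
by rewrite rig_mul_class -[RHS]/(rig_marks _ H * rig_marks _ H) !rig_marksE num_fixed_prod PoszM.
Qed.

HB.instance Definition _ :=
  GRing.isNmodMorphism.Build _ _ rig_marks rig_marks_nmod.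
HB.instance Definition _ :=
  GRing.isMonoidMorphism.Build _ _ rig_marks rig_marks_monoid.

End RigMarks.

Lemma same_marks_representatives (G : groupoid) (rep : set (subgroupoid1 G))
    (X Y : fin_gset G) : conj_representatives rep ->
  (forall H, rep H -> num_fixed_points X H = num_fixed_points Y H) ->
  same_marks X Y.
Proof.
move=> hrep XY H; have [K [[repK HK] _]] := hrep H.
by rewrite !(num_fixed_conj _ HK) XY.
Qed.

Theorem proposition7p2 (G : fin_groupoid) (rep : set (subgroupoid1 G))
    (hrep : conj_representatives rep) :
  exists ghost : {rmorphism burnside_ring G -> (rep -> int)},
    (forall (X Y : fin_gset G) (H : rep),
       ghost (groth_class (iso_class X) (iso_class Y)) H =
         (num_fixed_points X (val H))%:Z - (num_fixed_points Y (val H))%:Z) /\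
    injective ghost.
Proof.
pose ghost : {rmorphism burnside_ring G -> (rep -> int)} :=
  groth_lift (@rig_marks G rep).
have ghostE a b : ghost (groth_class a b) = rig_marks a - rig_marks b.
  exact: groth_liftE.
exists ghost; split=> [X Y H|].
  by rewrite ghostE -[LHS]/(rig_marks _ H - rig_marks _ H) !rig_marksE.
elim/groth_ind=> a b; elim/groth_ind=> c d; rewrite !ghostE => E.
apply/groth_classP; exists 0; rewrite !addr0.
(* f a - f b = f c - f d is the additive equality f (a + d) = f (c + b). *)
have {E} : rig_marks (a + d) = rig_marks (c + b) :> (rep -> int).
  by apply/eqP; rewrite !rmorphD -subr_eq addrAC E subrK.
rewrite -(iso_reprK (a + d)) -(iso_reprK (c + b)) => E.
apply/iso_classP/same_marks_iso/(same_marks_representatives hrep) => H repH.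
have := congr1 (fun m => m (exist _ H (mem_set repH))) E.
by rewrite !rig_marksE => -[].
Qed.
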